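(* Let $\bm q=(q_0,q_1,\ldots,q_n)$, with $q_i\in\mathcal{S}^h(\mathbb{R}^2)$ and with $W_{\bm q}$ surjective, let $$\bm \varphi:\mathbb{R}\setminus \mathcal{Z}(q_0(1,Z))\to\mathbb{R}^n;\quad z\mapsto\left(\frac{q_1(1,z)}{q_0(1,z)},\ldots,\frac{q_n(1,z)}{q_0(1,z)}\right)$$ and assume that $q_0(1,Z)^k$ is non-negative on $\mathbb{R}$. Let $\mathcal{C}:=\mathrm{Im}(\bm \varphi)$ and let $\mu$ be a positive Borel measure supported on $\mathcal{C}$ (with finite moments up to degree $k$). Let $p_{\bm\alpha}=\int X_1^{\alpha_1}\cdots X_n^{\alpha_n}\,\mathrm{d}\mu$ for $\bm\alpha=(\alpha_1, \ldots, \alpha_n)\in \mathbb{N}_0^n$, $|\bm\alpha|\leq k$, and let $$p:=\sum_{\bm\alpha\in \mathbb{N}_0^n,\, |\bm\alpha|\leq k}\binom{k}{(k-|\bm\alpha|,\alpha_1,\ldots,\alpha_n)}p_{\bm\alpha}X_0^{k-|\bm\alpha|}X_1^{\alpha_1}\cdots X_n^{\alpha_n}.$$ Then $p$ is a $\bm q$-Symmetric tensor. Moreover, let $\psi_{\bm q}(p)=\sum_{j=0}^{hk}\binom{hk}{j}c_jZ_0^{hk-j}Z_1^j$, $H=\operatorname{Hankel}((c_0,\ldots,c_{hk}))$, $r=\mathrm{rank}(H)\leq \lceil\frac{hk+1}{2}\rceil$. Then there exists a quadrature formula of strength $k$ for $\mu$ with $r$ nodes on $\mathcal{C}$ if $r\neq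 \frac{hk+1}{2}$, and with $r+1$ nodes on $\mathcal{C}$ otherwise.
   Context: Let $n,k,h$ be positive integers and $\mathbb{N}_0=\{0,1,2,\dots\}$. $\mathcal{S}^d(\mathbb{R}^{N+1})$ is the space of real homogeneous polynomials (forms) of degree $d$ in $N+1$ variables; variables are $\bm X=(X_0,\dots,X_n)$ for $\mathcal{S}^k(\mathbb{R}^{n+1})$ and $\bm Z=(Z_0,Z_1)$ for binary forms. $\mathcal{Z}(f)$ denotes the set of real zeros of $f$. $\binom{d}{\bm\alpha}=\frac{d!}{\prod\alpha_i!}$. $W_{\bm q}:\mathcal{S}^k(\mathbb{R}^{n+1})\to\mathcal{S}^{hk}(\mathbb{R}^{2})$ is the linear map $\bm X^{\bm\alpha}\mapsto \bm q(\bm Z)^{\bm\alpha}=\prod_i q_i(\bm Z)^{\alpha_i}$. The apolar product on degree $d$ forms is $\langle f,g\rangle_d=\sum_{\bm\alpha}\binom{d}{\bm\alpha}^{-1}f_{\bm\alpha}g_{\bm\alpha}$ (where $f_{\bm\alpha},g_{\bm\alpha}$ are the monomial coefficients), and $A_d$ is the isomorphism $f\mapsto\langle f,\cdot\rangle_d$ onto the dual space. Put $\phi_{\bm q}=A_k^{-1}\circ W_{\bm q}^*\circ A_{hk}:\mathcal{S}^{hk}(\mathbb{R}^{2})\to\mathcal{S}^k(\mathbb{R}^{n+1})$, with $W_{\bm q}^*$ the transpose of $W_{\bm q}$. The $\bm q$-Symmetric tensors are the elements of $\bm q\text{-}\mathrm{Sym}_{k,n+1}:=\mathrm{Im}(\phi_{\bm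 q})$. When $W_{\bm q}$ is surjective, $\phi_{\bm q}$ is injective and $\psi_{\bm q}:\bm q\text{-}\mathrm{Sym}_{k,n+1}\to\mathcal{S}^{hk}(\mathbb{R}^2)$ denotes its inverse. For $\bm c=(c_0,\dots,c_l)$, $\operatorname{Hankel}(\bm c)$ is the $(\lfloor l/2\rfloor+1)\times(\lceil l/2\rceil+1)$ matrix with entries $c_{i+j}$. A measure is supported on $\mathcal{C}$ if the complement of $\mathcal{C}$ has measure zero. A quadrature formula of strength $k$ for $\mu$ is a finitely atomic measure $\nu=\sum_{i=1}^s\lambda_i\delta_{\bm\xi_i}$ with $\lambda_i>0$, $\bm\xi_i\in\mathbb{R}^n$ (distinct; the nodes; $s$ is the number of nodes), such that the moments of $\mu$ and $\nu$ coincide up to degree $k$; its nodes are on $\mathcal{C}$ if $\bm\xi_i\in\mathcal{C}$ for all $i$. *)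

(* Defs.v *)
From HB Require Import structures.
From mathcomp Require Import all_boot all_order all_algebra.
(* The notations of mpoly clash with those of mathcomp-analysis. *)
From mathcomp Require Export -(notations) mpoly.
From mathcomp Require Import all_classical all_reals all_analysis.

Set Implicit Arguments.
Unset Strict Implicit.
Unset Printing Implicit Defensive.

Import Order.TTheory GRing.Theory Num.Theory.
Import numFieldNormedType.Exports.

Local Open Scope classical_set_scope.
Local Open Scope ring_scope.

(* dhomog N R d is a vectType only when N is a successor. *)
Notation Sform R N d := (dhomog N R d).

Definition multinomial_coef (R : realType) (N : nat) (a : multinom N) : R :=
  (mdeg a)`!%:R / (\prod_(i < N) (a i)`!)%:R.

Section Apolar.
Context {R : realType} (N d : nat).

Definition apolar (f g : Sform R N.+1 d) : R^o :=
  \sum_(a : bmultinom N.+1 d.+1 | mdeg a == d)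
     (multinomial_coef R a)^-1 * mcoeff a f * mcoeff a g.

Lemma apolar_linear f : linear (apolar f).
Proof.
move=> c g1 g2; rewrite /apolar scaler_sumr -big_split /=.
apply: eq_bigr => a _; rewrite linearP /= mulrDr; congr (_ + _).
by rewrite /GRing.scale /= mulrCA.
Qed.

HB.instance Definition _ f :=
  GRing.isLinear.Build R (Sform R N.+1 d) R^o _ (apolar f) (apolar_linear f).

Definition apolar_dual (f : Sform R N.+1 d) : 'Hom(Sform R N.+1 d, R^o) :=
  linfun (apolar f).

Lemma apolar_dual_linear : linear apolar_dual.
Proof.
move=> c f1 f2; apply/lfunP => g; rewrite add_lfunE scale_lfunE !lfunE /=.
rewrite /apolar scaler_sumr -big_split /=; apply: eq_bigr => a _.
rewrite linearP /= mulrDr mulrDl; congr (_ + _).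
by rewrite /GRing.scale /= mulrCA -!mulrA.
Qed.

HB.instance Definition _ :=
  GRing.isLinear.Build R (Sform R N.+1 d) 'Hom(Sform R N.+1 d, R^o) _
    apolar_dual apolar_dual_linear.

Definition apolar_iso : 'Hom(Sform R N.+1 d, 'Hom(Sform R N.+1 d, R^o)) :=
  linfun apolar_dual.

Lemma apolar_iso_inj : lker apolar_iso == 0%VS.
Proof.
apply/lker0P => f g /lfunP fg; apply/val_inj/mpolyP => a.
have [ad|ad] := eqVneq (mdeg a) d; last first.
  by rewrite !(dhomog_nemf_coeff (dhomog_is_dhomog _) ad).
have aX : mpolyX R a \is ishomog1 d mdeg by rewrite dhomogX; apply/eqP.
have apX u : apolar u (DHomog aX) = (multinomial_coef R a)^-1 * mcoeff a u.
  have lt_a : (mdeg a < d.+1)%N by rewrite ad.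
  rewrite /apolar (bigD1 (BMultinom lt_a)) /=; last exact/eqP.
  rewrite mcoeffX eqxx mulr1 big1 ?addr0 // => b /andP[_ nb].
  rewrite mcoeffX; case: eqP => [e|_]; last by rewrite mulr0.
  by move: nb; rewrite -val_eqE /= -e eqxx.
have := fg (DHomog aX); rewrite !lfunE /= !apX.
have fact_neq0 m : (m`!)%:R != 0 :> R by rewrite pnatr_eq0 -lt0n fact_gt0.
have prod_neq0 : (\prod_(i < N.+1) (a i)`!)%:R != 0 :> R.
  by rewrite natr_prod; apply/prodf_neq0.
by apply: mulfI; rewrite invr_eq0 mulf_eq0 invr_eq0 negb_or fact_neq0.
Qed.

Lemma apolar_iso_surj : limg apolar_iso = fullv.
Proof.
apply/eqP; rewrite eqEdim subvf /= limg_dim_eq ?(eqP apolar_iso_inj) ?capv0 //.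
by rewrite !dimvf /dim /= muln1.
Qed.

End Apolar.
Arguments apolar_iso {R} N d.

Section Transpose.
Context {R : realType} {U V : vectType R} (W : 'Hom(U, V)).

Definition precomp (l : 'Hom(V, R^o)) : 'Hom(U, R^o) := (l \o W)%VF.

Lemma precomp_linear : linear precomp.
Proof. by move=> c l1 l2; rewrite /precomp comp_lfunDl comp_lfunZl. Qed.

HB.instance Definition _ :=
  GRing.isLinear.Build R 'Hom(V, R^o) 'Hom(U, R^o) _ precomp precomp_linear.

Definition transpose : 'Hom('Hom(V, R^o), 'Hom(U, R^o)) := linfun precomp.

Lemma transposeE l u : transpose l u = l (W u).
Proof. by rewrite lfunE /= comp_lfunE. Qed.

End Transpose.

Section QSymmetric.
Context {R : realType} {n h : nat} (k : nat) (q : 'I_n.+1 -> Sform R 2 h).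

Let qtuple : n.+1.-tuple (mpoly 2 R) := [tuple val (q i) | i < n.+1].

Lemma comp_form_homog (f : Sform R n.+1 k) :
  comp_mpoly qtuple (val f) \is ishomog1 (h * k)%N mdeg.
Proof.
rewrite comp_mpolyEX big_seq rpred_sum // => a af; apply: rpredZ.
have <- : mdeg a = k := dhomog_mf (dhomog_is_dhomog f) af.
rewrite comp_mpolyX mdegE big_distrr /=.
pose P (p : mpoly 2 R) e := p \is ishomog1 e mdeg.
apply: (big_ind2 P) => [|p d p' d'|i _]; rewrite /P; first exact: dhomog1.
  exact: dhomogM.
by rewrite tnth_mktuple; apply: dhomogMn; apply: dhomog_is_dhomog.
Qed.

Definition comp_form (f : Sform R n.+1 k) : Sform R 2 (h * k) :=
  DHomog (comp_form_homog f).

Lemma comp_form_linear : linear comp_form.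
Proof. by move=> c f g; apply: val_inj; rewrite /= linearP. Qed.

HB.instance Definition _ :=
  GRing.isLinear.Build R (Sform R n.+1 k) (Sform R 2 (h * k)) _
    comp_form comp_form_linear.

Definition W_q : 'Hom(Sform R n.+1 k, Sform R 2 (h * k)) := linfun comp_form.

(* apolar_iso is bijective (apolar_iso_inj, apolar_iso_surj), so that here
   ^-1%VF is a two-sided inverse. *)
Definition phi_q : 'Hom(Sform R 2 (h * k), Sform R n.+1 k) :=
  ((apolar_iso n k)^-1 \o transpose W_q \o apolar_iso 1 (h * k))%VF.

Definition qSym : {vspace Sform R n.+1 k} := limg phi_q.

(* When W_q is surjective, phi_q is injective (phi_q_inj) and psi_q is its
   inverse on qSym; the values of psi_q outside qSym are irrelevant. *)
Definition psi_q : 'Hom(Sform R n.+1 k, Sform R 2 (h * k)) := (phi_q^-1)%VF.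

Lemma phi_q_inj : limg W_q = fullv -> lker phi_q == 0%VS.
Proof.
move=> W_surj; rewrite -subv0; apply/subvP => f; rewrite memv_ker memv0.
rewrite /phi_q !comp_lfunE => /eqP /(congr1 (apolar_iso n k)).
rewrite limg_lfunVK ?apolar_iso_surj ?memvf // linear0 => tAf0.
have Af0 : apolar_iso 1 (h * k) f = 0.
  apply/lfunP => g; have : g \in limg W_q by rewrite W_surj memvf.
  case/memv_imgP => u _ ->; move/lfunP: tAf0 => /(_ u).
  by rewrite transposeE !zero_lfunE.
by rewrite -memv0 -(eqP (apolar_iso_inj 1 (h * k))) memv_ker Af0.
Qed.

End QSymmetric.

Section Curve.
Context {R : realType} {n h : nat} (q : 'I_n.+1 -> Sform R 2 h).

(* f(1, z) *)
Definition dehomog (f : Sform R 2 h) (z : R) : R :=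
  meval (tnth [tuple 1; z]) (val f).

(* The ith affine coordinate, i : 'I_n, is q_(i+1) / q_0. *)
Definition varphi (z : R) : 'rV[R]_n :=
  \row_(i < n) (dehomog (q (lift ord0 i)) z / dehomog (q ord0) z).

Definition curve : set 'rV[R]_n :=
  varphi @` [set z | dehomog (q ord0) z != 0].

End Curve.

Definition Hankel (R : realType) (l : nat) (c : l.+1.-tuple R) :
    'M[R]_(l./2.+1, (uphalf l).+1) :=
  \matrix_(i, j) c`_(i + j)%N.

Notation borel R n := (g_sigma_algebraType (@open 'rV[R]_n)).

Section Quadrature.
Context {R : realType} {n : nat}.
Implicit Types (mu nu : {measure set (borel R n) -> \bar R}).
Implicit Types (C : set 'rV[R]_n) (k : nat).

Definition monomial (a : multinom n) (x : 'rV[R]_n) : R :=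
  \prod_(i < n) x 0 i ^+ a i.

Definition finite_moments mu k :=
  forall a : multinom n, (mdeg a <= k)%N ->
    mu.-integrable [set: borel R n] (EFin \o monomial a).

(* C need not be measurable a priori, so "measure zero" is negligibility. *)
Definition supported_on mu C := mu.-negligible (~` C).

Definition moment mu (a : multinom n) : R :=
  (\int[mu]_(x in [set: borel R n]) monomial a x)%R.

(* (k - |a|, a_1, ..., a_n) *)
Definition homog_exponent k (a : multinom n) : multinom n.+1 :=
  Multinom [tuple if unlift ord0 i is Some j then a j else (k - mdeg a)%N
           | i < n.+1].

Definition moment_poly mu k : mpoly n.+1 R :=
  \sum_(a : bmultinom n k.+1)
     (multinomial_coef R (homog_exponent k a) * moment mu a)
       *: mpolyX R (homog_exponent k a).

Lemma moment_poly_homog mu k : moment_poly mu k \is ishomog1 k mdeg.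
Proof.
rewrite rpred_sum // => a _; apply: rpredZ; rewrite dhomogX /=; apply/eqP.
rewrite mdegE big_ord_recl mnmE unlift_none -[RHS](@subnK (mdeg a)); last first.
  by rewrite -ltnS bmdeg.
by congr (_ + _)%N; rewrite mdegE; apply: eq_bigr => i _; rewrite mnmE liftK.
Qed.

Definition moment_form mu k : Sform R n.+1 k :=
  DHomog (moment_poly_homog mu k).

(* nu = \sum_i lambda_i \d_(xi_i) has exactly s (distinct) nodes, all on C. *)
Definition quadrature_formula mu k s C nu :=
  exists (lambda : 'I_s -> R) (xi : 'I_s -> 'rV[R]_n),
    [/\ forall i, 0 < lambda i,
        injective xi,
        forall i, C (xi i),
        forall B : set (borel R n), measurable B ->
          nu B = (\sum_(i < s) (lambda i)%:E * \d_(xi i : borel R n) B)%E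
      & forall a : multinom n, (mdeg a <= k)%N ->
          (\int[mu]_x (monomial a x)%:E = \int[nu]_x (monomial a x)%:E)%E].

End Quadrature.

Definition binary_exponent (i j : nat) : multinom 2 := Multinom [tuple i; j].

(* Main.v *)
(* A form f of degree k restricts to the curve as f(q(1, z)) = q_0(1, z)^k
   f(1, phi(z)). Hence f |-> int f(1, x) dmu vanishes on the kernel of W_q,
   which makes p a q-symmetric tensor, and psi_q(p) encodes the functional
   Lam : X^j |-> c_j on polynomials of degree at most d = hk, where Lam(G) =
   int F dmu for any F with G = q_0^k F(phi).
   If Lam(g^2) = 0 for some nonzero g of degree at most m = floor(d/2), then
   mu is carried by the images of the zeros of g; it is its own quadrature
   formula, and the factorization of the Hankel matrix through Vandermonde
   matrices shows that its rank is the number of atoms.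
   Otherwise Lam is positive definite, the Hankel matrix has rank m+1, and
   Gauss quadrature with one prescribed node, chosen generically so that no
   node is a zero of q_0, gives m+1 nodes when d is even; when d is odd, Lam
   is first extended to degree d+1, which gives m+2 nodes. Nodes are pushed
   forward by phi, and the weights are multiplied by q_0^k. *)
From HB Require Import structures.
Require Import Defs.
From mathcomp Require Import all_boot all_order all_algebra.
From mathcomp Require Import complex polyrcf ring zify.
From mathcomp Require Import all_classical all_reals all_analysis.
From mathcomp Require Import measurable_realfun.

Set Implicit Arguments.
Unset Strict Implicit.
Unset Printing Implicit Defensive.

Import Order.TTheory GRing.Theory Num.Theory.
Import numFieldNormedType.Exports.

Local Open Scope classical_set_scope.
Local Open Scope ring_scope.

(** * Univariate polynomials and Gauss quadrature *)

Lemma uniq_prod_XsubC (F : fieldType) (s : seq F) :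
  (forall a, ~~ (('X - a%:P) ^+ 2 %| \prod_(z <- s) ('X - z%:P))) -> uniq s.
Proof.
elim: s => //= x s IHs sqf; apply/andP; split; last first.
  apply: IHs => a; apply: contra (sqf a) => ?.
  by rewrite big_cons; apply: dvdp_mull.
apply: contra (sqf x) => xs; rewrite big_cons expr2 dvdp_mul //.
by rewrite dvdp_XsubCl root_prod_XsubC.
Qed.

(** The quadratic is the minimal polynomial of [a + bi]. The remainder of [p] has degree at most 1
    and vanishes there: the imaginary part kills its slope, then the real part its constant term. *)
Lemma dvdp_complex_root (R : rcfType) (p : {poly R}) (a b : R) :
  b != 0 -> root (map_poly (real_complex R) p) (Complex a b) ->
  ('X - a%:P) ^+ 2 + (b ^+ 2)%:P %| p.
Proof.
move=> b0; set q := _ + _ => pz.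
have qm : q \is monic.
  rewrite monicE lead_coefDl ?lead_coef_exp ?lead_coefXsubC ?expr1n //.
  by rewrite size_exp_XsubC ltnS (leq_trans (size_polyC_leq1 _)).
have sq : size q = 3%N.
  by rewrite size_polyDl ?size_exp_XsubC // ltnS (leq_trans (size_polyC_leq1 _)).
have q0 : q != 0 by rewrite -size_poly_eq0 sq.
have qz : root (map_poly (real_complex R) q) (Complex a b).
  rewrite /root rmorphD rmorphXn /= rmorphB /= map_polyX !map_polyC /= !hornerE /=.
  apply/eqP; rewrite expr2; simpc.
  by rewrite expr2 addNr.
rewrite /dvdp; set r := p %% q.
have rz : root (map_poly (real_complex R) r) (Complex a b).
  have : p = p %/ q * q + r := divp_eq p q.
  move: pz => /[swap] ->; rewrite /root rmorphD rmorphM /= hornerD hornerM.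
  by rewrite (eqP qz) mulr0 add0r.
have sr : (size r <= 2)%N by rewrite -ltnS -sq ltn_modp.
have rE : r = r`_1 *: 'X + (r`_0)%:P.
  apply/polyP => -[|[|i]]; rewrite !coefE ?simp ?mulr1 ?mulr0 ?add0r ?addr0 //.
  by rewrite nth_default // (leq_trans sr).
move: rz; rewrite rE /root rmorphD /= map_polyZ map_polyX map_polyC /= !hornerE.
rewrite /= => /eqP; simpc; case => h1 h2.
have r1 : r`_1 = 0 by move/eqP: h2; rewrite mulf_eq0 (negPf b0) orbF => /eqP.
by move: h1; rewrite r1 mul0r add0r => ->; rewrite scale0r addr0.
Qed.

(** The case [b != 0] excludes non-real roots, the case [b = 0] multiple ones. *)
Lemma rcf_split_simple (R : rcfType) (p : {poly R}) :
  p != 0 -> (forall a b, ~~ (('X - a%:P) ^+ 2 + (b ^+ 2)%:P %| p)) ->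
  exists2 s, uniq s & p = lead_coef p *: \prod_(z <- s) ('X - z%:P).
Proof.
move=> p0 pnd; pose pC := map_poly (real_complex R) p.
have [rs pE] := closed_field_poly_normal pC.
have rs_real z : z \in rs -> (complex.Re z)%:C%C = z.
  move=> zrs; have : root pC z.
    rewrite pE rootZ ?root_prod_XsubC // lead_coef_eq0.
    by rewrite map_poly_eq0.
  case: z {zrs} => a b rz; have [->|b0] := eqVneq b 0; first by [].
  by have := pnd a b; rewrite dvdp_complex_root.
pose s := [seq complex.Re z | z <- rs].
have psE : p = lead_coef p *: \prod_(z <- s) ('X - z%:P).
  apply: (map_poly_inj (real_complex R)); rewrite map_polyZ /= -/pC pE.
  rewrite lead_coef_map rmorph_prod /= big_map; congr (_ *: _).
  rewrite [LHS]big_seq [RHS]big_seq; apply: eq_bigr => z /rs_real zE.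
  by rewrite rmorphB /= map_polyX map_polyC /= zE.
exists s => //; apply: uniq_prod_XsubC => a.
have := pnd a 0; rewrite expr0n addr0 psE dvdpZr //.
by rewrite lead_coef_eq0.
Qed.

(** Here [m] bounds the size, so [Lam (f * g)] is an inner product on polynomials of degree less
    than [m]. *)
Definition pos_def (R : realFieldType) (Lam : {scalar {poly R}}) (m : nat) :=
  forall g : {poly R}, g != 0 -> (size g <= m)%N -> 0 < Lam (g ^+ 2).

Lemma scalar_poly_sum (R : comNzRingType) (Lam : {scalar {poly R}}) m (p g : {poly R}) :
  (size g <= m)%N -> Lam (p * g) = \sum_(j < m) g`_j * Lam (p * 'X^j).
Proof.
move=> sg; have -> : g = \sum_(j < m) g`_j *: 'X^j.
  apply/polyP => i; rewrite -poly_def coef_poly; case: ltnP => // mi.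
  by rewrite nth_default // (leq_trans sg).
rewrite mulr_sumr linear_sum /=; apply: eq_bigr => j _.
rewrite -scalerAr linearZ /=; congr (_ * _).
by rewrite -poly_def coef_poly ltn_ord.
Qed.

Lemma pos_def_eq0 (R : realFieldType) (Lam : {scalar {poly R}}) m (g : {poly R}) :
  pos_def Lam m -> (size g <= m)%N ->
  (forall j : 'I_m, Lam (g * 'X^j) = 0) -> g = 0.
Proof.
move=> Lpd sg gX; apply/eqP; apply: contraT => g0; have := Lpd g g0 sg.
by rewrite expr2 (scalar_poly_sum _ _ sg) big1 ?ltxx // => j _; rewrite gX mulr0.
Qed.

Lemma size_poly_sqr (R : nzRingType) m (p : {poly R}) :
  (size p <= m.+1)%N -> (size (p ^+ 2) <= m.*2.+1)%N.
Proof.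
move=> sp; rewrite expr2; apply: leq_trans (size_polyMleq _ _) _.
rewrite -subn1 leq_subLR; apply: leq_trans (leq_add sp sp) _.
by rewrite addnS addSn addnn.
Qed.

(** The polynomial of degree less than [m] that represents [l] for the inner product [Lam (f * g)],
    found by inverting the Gram matrix of the monomials. *)
Definition riesz_poly (R : fieldType) (Lam l : {scalar {poly R}}) m : {poly R} :=
  rVpoly ((\row_(j < m) l 'X^j) *m
          invmx (\matrix_(i < m, j < m) Lam ('X^i * 'X^j))).

Lemma size_riesz_poly (R : fieldType) (Lam l : {scalar {poly R}}) m :
  (size (riesz_poly Lam l m) <= m)%N.
Proof. exact: size_poly. Qed.

Lemma riesz_polyP (R : realFieldType) (Lam l : {scalar {poly R}}) m
    (g : {poly R}) :
  pos_def Lam m -> (size g <= m)%N -> Lam (riesz_poly Lam l m * g) = l g.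
Proof.
move=> Lpd; rewrite /riesz_poly; set H := \matrix_(i < m, j < m) _ => sg.
have HE (v : 'rV_m) (j : 'I_m) : Lam (rVpoly v * 'X^j) = (v *m H) 0 j.
  rewrite mulrC (scalar_poly_sum _ _ (size_poly _ _)) mxE.
  by apply: eq_bigr => i _; rewrite mxE coef_rVpoly_ord ['X^j * _]mulrC.
(* A vector in the kernel of the Gram matrix is a polynomial orthogonal to every monomial. *)
have Hu : H \in unitmx.
  rewrite -row_free_unit; apply: inj_row_free => v vH0.
  apply: (can_inj (@rVpolyK _ m)); rewrite linear0.
  apply: (pos_def_eq0 Lpd) => [|j]; first exact: size_poly.
  by rewrite HE vH0 mxE.
rewrite (scalar_poly_sum _ _ sg) -[g in RHS]mul1r.
rewrite (scalar_poly_sum _ _ sg); apply: eq_bigr => j _.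
by rewrite HE mulmxKV // mxE mul1r.
Qed.

(** * Lagrange interpolation *)

Definition lagrange_basis (R : fieldType) (s : nat) (z : 'I_s -> R) (i : 'I_s) :
    {poly R} :=
  \prod_(j < s | j != i) ((z i - z j)^-1 *: ('X - (z j)%:P)).

Lemma size_lagrange_basis (R : fieldType) s (z : 'I_s -> R) i :
  (size (lagrange_basis z i) <= s)%N.
Proof.
rewrite /lagrange_basis scaler_prod; apply: leq_trans (size_scale_leq _ _) _.
rewrite -big_filter size_prod_XsubC size_filter.
rewrite -sum1_count (@sum1_card _ (predC1 i)) cardC1 card_ord.
by rewrite prednK // (leq_ltn_trans _ (ltn_ord i)).
Qed.

Lemma lagrange_basisE (R : fieldType) s (z : 'I_s -> R) i j :
  injective z -> (lagrange_basis z i).[z j] = (i == j)%:R.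
Proof.
move=> zI; rewrite /lagrange_basis horner_prod; have [<-|nij] := eqVneq.
  apply: big1 => l li; rewrite !hornerE mulVf // subr_eq0.
  by apply: contra li => /eqP/zI->.
by rewrite (bigD1 j) /= ?(eq_sym j) // !hornerE subrr mulr0 mul0r.
Qed.

(** The difference has size at most [s] but vanishes at [s] distinct nodes. *)
Lemma lagrange_interpolation (R : fieldType) s (z : 'I_s -> R) (p : {poly R}) :
  injective z -> (size p <= s)%N -> p = \sum_(i < s) p.[z i] *: lagrange_basis z i.
Proof.
move=> zI sp; apply/eqP; rewrite -subr_eq0; apply: contraT => d0.
pose rs := [seq z i | i <- enum 'I_s].
have : (size rs < size (p - \sum_(i < s) p.[z i] *: lagrange_basis z i)%R)%N.
  apply: max_poly_roots => //; last by rewrite map_inj_uniq // enum_uniq.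
  apply/allP => _ /mapP[j _ ->]; rewrite /root hornerD hornerN horner_sum.
  rewrite (bigD1 j) //= big1 => [|i ij]; last first.
    by rewrite hornerZ lagrange_basisE // (negPf ij) mulr0.
  by rewrite hornerZ lagrange_basisE // eqxx mulr1 addr0 subrr.
rewrite size_map size_enum_ord ltnNge (leq_trans (size_polyD _ _)) //.
rewrite geq_max sp size_polyN (leq_trans (size_sum _ _ _)) //.
apply/bigmax_leqP => i _.
by rewrite (leq_trans (size_scale_leq _ _)) // size_lagrange_basis.
Qed.

Lemma exists_nonroot (R : numDomainType) (p : {poly R}) :
  p != 0 -> exists x, ~~ root p x.
Proof.
move=> p0; pose t : seq R := [seq i%:R | i <- iota 0 (size p)].
case: (boolP (all (root p) t)) => [pt|/allPn[x _ xs]]; last by exists x.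
have : (size t < size p)%N.
  apply: max_poly_roots => //; rewrite map_inj_uniq ?iota_uniq //.
  by move=> i j /eqP; rewrite eqr_nat => /eqP.
by rewrite size_map size_iota ltnn.
Qed.

(* The nodes are x and the zeros of the reproducing kernel K(x, .) of Lam on
   polynomials of degree at most m. Since K is symmetric, K(x, b) = 0 holds for
   finitely many x only when b is fixed. *)
Lemma gauss_quadrature (R : rcfType) (Lam : {scalar {poly R}}) m (bad : seq R) :
  pos_def Lam m.+1 ->
  exists (z w : 'I_m.+1 -> R),
    [/\ injective z, forall i, z i \notin bad, forall i, 0 < w i &
      forall p : {poly R}, (size p <= m.*2.+1)%N ->
        Lam p = \sum_(i < m.+1) w i * p.[z i]].
Proof.
move=> Lpd; pose K x := riesz_poly Lam (horner_eval x) m.+1.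
have KP x (g : {poly R}) : (size g <= m.+1)%N -> Lam (K x * g) = g.[x].
  by move=> sg; rewrite riesz_polyP.
have sK x : (size (K x) <= m.+1)%N := size_riesz_poly _ _ _.
have K0 x : K x != 0.
  apply/eqP => Kx0; have := KP x 1; rewrite Kx0 mul0r linear0 hornerC size_poly1.
  by move=> /(_ isT)/esym/eqP; rewrite oner_eq0.
(* [P.[x] = Lam (P * K x)] is the coefficient of [X^m] in [K x], so [K x] has degree exactly [m]
   wherever [P] does not vanish. *)
pose P := riesz_poly Lam (coefp m) m.+1.
have P0 : P != 0.
  apply/eqP => P0; have := @riesz_polyP _ Lam (coefp m) _ 'X^m Lpd.
  rewrite -/P P0 mul0r linear0 size_polyXn /= coefXn eqxx.
  by move=> /(_ (leqnn _))/esym/eqP; rewrite oner_eq0.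
(* A non-root [x] of [N] lies outside [bad], makes [K x] of degree [m], and satisfies [(K b).[x] !=
   0], hence by symmetry [(K x).[b] != 0], for each [b] in [bad]. *)
pose N := P * \prod_(b <- bad) (K b * ('X - b%:P)).
have [|x] := @exists_nonroot R N.
  rewrite mulf_neq0 // prodf_seq_neq0; apply/allP => b _ /=.
  by rewrite mulf_neq0 // polyXsubC_eq0.
rewrite rootM negb_or => /andP[Px].
rewrite /root horner_prod prodf_seq_neq0 => /allP /= badx.
have K_sym a b : (K a).[b] = (K b).[a] by rewrite -!KP // mulrC.
have sKx : size (K x) = m.+1.
  apply/eqP; rewrite eqn_leq sK ltnNge; apply: contra Px => sKm.
  rewrite /root -(KP x) ?size_riesz_poly // mulrC riesz_polyP //=.
  by rewrite nth_default.
pose pi := ('X - x%:P) * K x.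
have spi : size pi = m.+2.
  by rewrite size_mul ?polyXsubC_eq0 // size_XsubC sKx.
have pi0 : pi != 0 by rewrite -size_poly_eq0 spi.
(* The reproducing property turns [Lam (pi * g)] into the value of [('X - x%:P) * g] at [x]. *)
have orth (g : {poly R}) : (size g <= m)%N -> Lam (pi * g) = 0.
  move=> sg; rewrite /pi mulrC mulrA mulrC KP.
    by rewrite hornerM hornerXsubC subrr mulr0.
  by rewrite (leq_trans (size_polyMleq _ _)) // size_XsubC addnC /= addn1 ltnS.
have [a b|s us piE] := rcf_split_simple pi0.
  (* If the quotient is [g], of size [m], then [Lam (pi * g)] is a sum of two squares under [Lam],
     the first positive, against orthogonality. *)
  apply/negP; set Q := _ + _ => /dvdpP[g piE].
  have sQ : size Q = 3%N.
    rewrite size_polyDl ?size_exp_XsubC // ltnS.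
    by rewrite (leq_trans (size_polyC_leq1 _)).
  have g0 : g != 0 by apply: contra_neq pi0; rewrite piE => ->; rewrite mul0r.
  have sg : size g = m.
    have := spi; rewrite piE size_mul -?size_poly_eq0 ?sQ //.
      by rewrite addn3 => -[].
    by rewrite size_poly_eq0.
  have := orth g; rewrite sg leqnn => /(_ isT)/eqP; apply/negP.
  have -> : pi * g = ((g * ('X - a%:P)) ^+ 2) + (b ^+ 2) *: g ^+ 2.
    by rewrite piE /Q -mul_polyC; ring.
  rewrite linearD linearZ /= gt_eqF // ltr_wpDr //.
    by rewrite mulr_ge0 ?sqr_ge0 // ltW // Lpd // sg.
  apply: Lpd; first by rewrite mulf_neq0 // polyXsubC_eq0.
  by rewrite size_mul ?polyXsubC_eq0 // size_XsubC sg addn2.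
have ss : size s = m.+1.
  have := spi; rewrite piE size_scale ?lead_coef_eq0 //.
  by rewrite size_prod_XsubC => -[].
pose z (i : 'I_m.+1) := s`_i.
have zI : injective z.
  move=> i j /eqP; rewrite nth_uniq ?ss // => /eqP ij.
  exact: val_inj.
have piz i : root pi (z i).
  by rewrite piE rootZ ?lead_coef_eq0 // root_prod_XsubC mem_nth // ss.
pose w i := Lam (lagrange_basis z i).
have exact_ (p : {poly R}) : (size p <= m.*2.+1)%N -> Lam p = \sum_(i < m.+1) w i * p.[z i].
  (* After division by [pi], the quotient has size at most [m] and is killed by orthogonality; the
     remainder agrees with [p] at the nodes and is interpolated. *)
  move=> sp; rewrite [in LHS](divp_eq p pi) linearD /= mulrC orth ?add0r.
    rewrite [in LHS](@lagrange_interpolation _ _ z (p %% pi)) //.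
      rewrite linear_sum; apply: eq_bigr => i _; rewrite linearZ /= mulrC.
      congr (_ * _); rewrite [in RHS](divp_eq p pi) hornerD hornerM.
      by rewrite (eqP (piz i)) mulr0 add0r.
    by rewrite -ltnS -spi ltn_modp.
  by rewrite size_divp // spi leq_subLR addSn addnn.
exists z, w; split=> // i.
  apply/negP => /badx; rewrite hornerM mulf_eq0 negb_or !hornerE.
  rewrite -K_sym; have := piz i; rewrite /root hornerM !hornerE mulf_eq0.
  rewrite (subr_eq0 _ x) (subr_eq0 x) eq_sym.
  by case/orP=> ->; rewrite ?andbF.
have L0 : lagrange_basis z i != 0.
  apply/eqP => Li0; have := lagrange_basisE i i zI; rewrite Li0 horner0 eqxx.
  by move/esym/eqP; rewrite oner_eq0.
(* The square of the basis polynomial has degree at most [2m], is 1 at [z i] and 0 at the other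
   nodes, so the rule gives it the value [w i]. *)
have := Lpd _ L0 (size_lagrange_basis z i); rewrite exact_; last first.
  exact: size_poly_sqr (size_lagrange_basis z i).
rewrite (bigD1 i) //= big1 => [|j ji]; last first.
  by rewrite horner_exp lagrange_basisE // eq_sym (negPf ji) expr0n mulr0.
by rewrite horner_exp lagrange_basisE // eqxx expr1n mulr1 addr0.
Qed.

Definition mul_scalar (R : comNzRingType) (Lam : {scalar {poly R}})
  (q p : {poly R}) : R := Lam (q * p).

Lemma mul_scalar_is_scalar (R : comNzRingType) (Lam : {scalar {poly R}}) q :
  scalar (mul_scalar Lam q).
Proof.
by move=> a p1 p2; rewrite /mul_scalar mulrDr -scalerAr linearD linearZ.
Qed.

HB.instance Definition _ (R : comNzRingType) (Lam : {scalar {poly R}}) q :=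
  GRing.isLinear.Build R {poly R} R _ (mul_scalar Lam q)
    (mul_scalar_is_scalar Lam q).

Definition add_coef (R : comNzRingType) (Lam : {scalar {poly R}}) T d
  (p : {poly R}) : R := Lam p + T * p`_d.

Lemma add_coef_is_scalar (R : comNzRingType) (Lam : {scalar {poly R}}) T d :
  scalar (add_coef Lam T d).
Proof.
by move=> a p1 p2; rewrite /add_coef linearD linearZ coefD coefZ /=; ring.
Qed.

HB.instance Definition _ (R : comNzRingType) (Lam : {scalar {poly R}}) T d :=
  GRing.isLinear.Build R {poly R} R _ (add_coef Lam T d)
    (add_coef_is_scalar Lam T d).

(* The functional is extended to degree 2m+2 by giving X^(2m+2) a value that is
   large enough for positive definiteness to persist. *)
Lemma gauss_quadrature_odd (R : rcfType) (Lam : {scalar {poly R}}) m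
    (bad : seq R) :
  pos_def Lam m.+1 ->
  exists (z w : 'I_m.+2 -> R),
    [/\ injective z, forall i, z i \notin bad, forall i, 0 < w i &
      forall p : {poly R}, (size p <= m.*2.+2)%N ->
        Lam p = \sum_(i < m.+2) w i * p.[z i]].
Proof.
(* [k] is the orthogonal projection of [X^(m+1)] onto the polynomials of degree at most [m]. *)
move=> Lpd; pose k := riesz_poly Lam (mul_scalar Lam 'X^(m.+1)) m.+1.
have sk : (size k <= m.+1)%N := size_riesz_poly _ _ _.
(* The new value at [X^(2m+2)] is then [Lam (k ^+ 2) + 1], which gives [X^(m+1) - k] squared norm
   1. *)
pose T := Lam (k ^+ 2) + 1 - Lam ('X^(m.+1) ^+ 2).
have Lpd' : pos_def (add_coef Lam T m.*2.+2) m.+2.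
  move=> g g0 sg; pose a := g`_m.+1; pose u := g - a *: 'X^(m.+1).
  have su : (size u <= m.+1)%N.
    apply/leq_sizeP => i; rewrite leq_eqVlt => /predU1P[<-|mi].
      by rewrite coefB coefZ coefXn eqxx mulr1 subrr.
    rewrite coefB coefZ coefXn gtn_eqF // mulr0 subr0 nth_default //.
    exact: leq_trans sg _.
  have gE : g = a *: 'X^(m.+1) + u by rewrite addrC subrK.
  have sq b (x y : {poly R}) : Lam ((b *: x + y) ^+ 2) =
      b ^+ 2 * Lam (x ^+ 2) + b *+ 2 * Lam (x * y) + Lam (y ^+ 2).
    rewrite (_ : _ ^+ 2 = b ^+ 2 *: x ^+ 2 + (b *+ 2) *: (x * y) + y ^+ 2).
      by rewrite !linearD /= [Lam (b ^+ 2 *: _)]linearZ [Lam (b *+ 2 *: _)]linearZ.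
    by rewrite -!mul_polyC; ring.
  have ku : Lam ('X^(m.+1) * u) = Lam (k * u) by rewrite riesz_polyP.
  have g2 : (g ^+ 2)`_m.*2.+2 = a ^+ 2.
    have -> : g ^+ 2 =
        a ^+ 2 *: 'X^(m.*2.+2) + (a *+ 2) *: u * 'X^(m.+1) + u ^+ 2.
      rewrite -doubleS -muln2 exprM gE -!mul_polyC; ring.
    rewrite !coefD coefZ coefXn eqxx mulr1 coefMXn coefZ.
    rewrite [(u ^+ 2)`__]nth_default; last exact: leq_trans (size_poly_sqr su) _.
    rewrite [u`__]nth_default; last by apply: leq_trans su _; lia.
    by rewrite mulr0 if_same !addr0.
  rewrite /= /add_coef g2.
  (* Pythagoras for [g] as the sum of [a] times [X^(m+1) - k] and the orthogonal polynomial
     [u + a *: k]. *)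
  have -> : Lam (g ^+ 2) + T * a ^+ 2 = Lam ((u + a *: k) ^+ 2) + a ^+ 2.
    by rewrite {1}gE sq addrC [u + _]addrC sq ku /T; ring.
  have [a0|a0] := eqVneq a 0.
    rewrite a0 expr0n addr0 scale0r addr0 Lpd //.
    by move: g0; rewrite gE a0 scale0r add0r.
  rewrite ltr_wpDl ?exprn_even_gt0 //.
  have [->|v0] := eqVneq (u + a *: k) 0; first by rewrite expr0n linear0.
  rewrite ltW // Lpd // (leq_trans (size_polyD _ _)) // geq_max su.
  by rewrite (leq_trans (size_scale_leq _ _)).
have [z [w [zI zb wp zw]]] := gauss_quadrature bad Lpd'.
exists z, w; split=> // p sp; rewrite -zw; last by rewrite doubleS (leq_trans sp).
by rewrite /= /add_coef nth_default // mulr0 addr0.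
Qed.

(** * Forms and the map W_q *)

(** Lets sums over the monomials of degree [d] run over a convenient type: ordinals for binary
    forms, exponents of degree at most [k] in [n] variables for affine coordinates. *)
Definition enumerates_deg N d (I : finType) (e : I -> multinom N) :=
  [/\ injective e, forall i, mdeg (e i) = d &
      forall a, mdeg a = d -> exists i, e i = a].

Lemma sum_mdeg (V : nmodType) N d (I : finType) (e : I -> multinom N)
    (F : multinom N -> V) :
  enumerates_deg d e ->
  \sum_(a : bmultinom N d.+1 | mdeg a == d) F a = \sum_i F (e i).
Proof.
case=> eI ed eS; transitivity (\sum_(x <- [seq bmnm a |
    a <- [seq a : bmultinom N d.+1 <- index_enum _ | mdeg a == d]]) F x).
  by rewrite big_map big_filter.
rewrite -(big_map e xpredT F); apply: perm_big; apply: uniq_perm.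
- by rewrite map_inj_uniq ?filter_uniq ?index_enum_uniq //; apply: val_inj.
- by rewrite map_inj_uniq ?index_enum_uniq.
move=> a; apply/mapP/mapP => -[].
  move=> b; rewrite mem_filter => /andP[/eqP/eS[i <-] _] ->.
  by exists i; rewrite ?mem_index_enum.
move=> i _ ->; have ei : (mdeg (e i) < d.+1)%N by rewrite ed.
by exists (BMultinom ei) => //; rewrite mem_filter mem_index_enum /= ed eqxx.
Qed.

Lemma meval_form (R : comNzRingType) N d (I : finType) (e : I -> multinom N)
    (f : Sform R N d) (v : 'I_N -> R) :
  enumerates_deg d e ->
  meval v (val f) = \sum_i mcoeff (e i) (val f) * \prod_(l < N) v l ^+ e i l.
Proof.
move=> enum_e; have fd : (mmeasure mdeg (val f) <= d.+1)%N.
  rewrite mmeasureE; apply/bigmax_leqP_seq => a af _.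
  by rewrite ltnS (dhomog_mf (dhomog_is_dhomog f) af).
rewrite [in LHS](mpolywE fd) raddf_sum /=.
rewrite -(sum_mdeg (fun a => mcoeff a (val f) * \prod_(l < N) v l ^+ a l) enum_e).
rewrite [RHS]big_mkcond; apply: eq_bigr => a _; rewrite mevalZ mevalX.
case: eqVneq => // ad.
by rewrite (dhomog_nemf_coeff (dhomog_is_dhomog f)) ?mul0r.
Qed.

Lemma apolarE (R : realType) N d (I : finType) (e : I -> multinom N.+1)
    (f g : Sform R N.+1 d) :
  enumerates_deg d e ->
  apolar f g = \sum_i (multinomial_coef R (e i))^-1 *
                 mcoeff (e i) (val f) * mcoeff (e i) (val g).
Proof.
exact: (sum_mdeg (fun a =>
  (multinomial_coef R a)^-1 * mcoeff a _ * mcoeff a _)).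
Qed.

Lemma multinomial_coef_neq0 (R : realType) N (a : multinom N) :
  multinomial_coef R a != 0.
Proof.
rewrite mulf_neq0 ?invr_eq0 ?pnatr_eq0 -?lt0n ?fact_gt0 //.
by rewrite prodn_gt0 // => i; apply: fact_gt0.
Qed.

Lemma homog_exponentE n k (a : multinom n) i :
  homog_exponent k a i = if unlift ord0 i is Some j then a j else (k - mdeg a)%N.
Proof. by rewrite mnmE. Qed.

Lemma homog_exponent_enum n k :
  enumerates_deg k (fun b : bmultinom n k.+1 => homog_exponent k b).
Proof.
split=> [b b' bb'|b|a ak].
- apply: val_inj; apply/mnmP => i.
  have : homog_exponent k b (lift ord0 i) = homog_exponent k b' (lift ord0 i).
    by rewrite bb'.
  by rewrite !homog_exponentE liftK.
- rewrite mdegE big_ord_recl homog_exponentE unlift_none.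
  rewrite (eq_bigr (b : multinom n)) => [|i _]; last by rewrite homog_exponentE liftK.
  by rewrite -mdegE subnK // -ltnS bmdeg.
pose b := Multinom [tuple a (lift ord0 i) | i < n].
have aE : mdeg a = (a ord0 + mdeg b)%N.
  by rewrite !mdegE big_ord_recl; congr addn; apply: eq_bigr => i _; rewrite mnmE.
have bk : (mdeg b < k.+1)%N by rewrite ltnS -ak aE leq_addl.
exists (BMultinom bk); apply/mnmP => i; rewrite homog_exponentE /=.
by case: unliftP => [j ->|->]; rewrite ?mnmE // -ak aE addnK.
Qed.

(** * Binary forms as univariate polynomials *)

Lemma binary_exponent_enum d :
  enumerates_deg d (fun j : 'I_d.+1 => binary_exponent (d - j) j).
Proof.
have binE i j : binary_exponent i j ord0 = i /\ binary_exponent i j (lift ord0 ord0) = j.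
  by [].
have mdeg2 (a : multinom 2) : mdeg a = (a ord0 + a (lift ord0 ord0))%N :> nat.
  by rewrite mdegE !big_ord_recl big_ord0 addn0.
split=> [j j' jj'|j|a ad].
- by apply: val_inj; rewrite /= -(binE (d - j)%N j).2 jj' (binE _ _).2.
- by rewrite mdeg2 (binE _ _).1 (binE _ _).2 subnK // -ltnS.
have lt_a : (a (lift ord0 ord0) < d.+1)%N by rewrite ltnS -ad mdeg2 leq_addl.
have a0 : (d - a (lift ord0 ord0))%N = a ord0 by rewrite -ad mdeg2 addnK.
exists (Ordinal lt_a); apply/mnmP => i.
by case: (unliftP ord0 i) => [j ->|->] //; rewrite (ord1 j).
Qed.

Lemma multinomial_coef_binary (R : realType) d j :
  (j <= d)%N -> multinomial_coef R (binary_exponent (d - j) j) = 'C(d, j)%:R.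
Proof.
move=> jd; have [_ /(_ (Ordinal (jd : j < d.+1)%N)) /= deg _] :=
  binary_exponent_enum d.
rewrite /multinomial_coef deg !big_ord_recl big_ord0 muln1.
rewrite -[binary_exponent _ _ ord0]/(d - j)%N -[binary_exponent _ _ _]/j.
by rewrite -(bin_fact jd) [(j`! * _)%N]mulnC natrM mulfK //.
Qed.

(** The functional [X^j |-> c_j], extended by 0 from [j = size c] on so that it is defined on all
    polynomials. *)
Definition coef_functional (R : comNzRingType) (c : seq R) (p : {poly R}) : R :=
  \sum_(j < size c) c`_j * p`_j.

Lemma coef_functional_is_scalar (R : comNzRingType) (c : seq R) :
  scalar (coef_functional c).
Proof.
move=> a p q; rewrite /coef_functional mulr_sumr -big_split /=.
by apply: eq_bigr => j _; rewrite coefD coefZ mulrDr mulrCA.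
Qed.

HB.instance Definition _ (R : comNzRingType) (c : seq R) :=
  GRing.isLinear.Build R {poly R} R _ (coef_functional c)
    (coef_functional_is_scalar c).

Lemma coef_functionalXn (R : comNzRingType) (c : seq R) j :
  coef_functional c 'X^j = c`_j.
Proof.
rewrite /coef_functional; case: (ltnP j (size c)) => [jc|cj].
  rewrite (bigD1 (Ordinal jc)) //= coefXn eqxx mulr1 big1 ?addr0 // => i ij.
  by rewrite coefXn -[_ == j]/(i == Ordinal jc) (negPf ij) mulr0.
rewrite big1 ?[RHS]nth_default // => i _; rewrite coefXn.
by rewrite ltn_eqF ?mulr0 // (leq_trans _ cj).
Qed.

Definition dehomog_poly (R : realType) d (g : Sform R 2 d) : {poly R} :=
  \poly_(j < d.+1) mcoeff (binary_exponent (d - j) j) (val g).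

Lemma horner_dehomog_poly (R : realType) d (g : Sform R 2 d) z :
  (dehomog_poly g).[z] = meval (tnth [tuple 1; z]) (val g).
Proof.
rewrite (meval_form _ _ (binary_exponent_enum d)) horner_poly.
apply: eq_bigr => j _; congr (_ * _).
by rewrite !big_ord_recl big_ord0 mulr1 expr1n mul1r.
Qed.

Lemma dehomog_poly_surj (R : realType) d (p : {poly R}) :
  (size p <= d.+1)%N -> exists g : Sform R 2 d, dehomog_poly g = p.
Proof.
move=> sp; have [bI bd _] := binary_exponent_enum d.
pose g := \sum_(j < d.+1) p`_j *: mpolyX R (binary_exponent (d - j) j).
have gh : g \is ishomog1 d mdeg.
  by rewrite rpred_sum // => j _; apply: rpredZ; rewrite dhomogX /= bd.
exists (DHomog gh); apply/polyP => i; rewrite coef_poly.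
case: ltnP => [id|di]; last by rewrite nth_default // (leq_trans sp).
rewrite /= raddf_sum /= (bigD1 (Ordinal id)) //= mcoeffZ mcoeffX eqxx mulr1.
rewrite big1 ?addr0 // => j ji; rewrite mcoeffZ mcoeffX.
case: eqP => [bji|_]; last by rewrite mulr0.
by case/eqP: ji; apply: bI.
Qed.

(** The binomial coefficients in [f] cancel the inverse ones of the apolar product. *)
Lemma apolar_binary (R : realType) d (c : d.+1.-tuple R) (f g : Sform R 2 d) :
  val f = \sum_(j < d.+1)
    ('C(d, j)%:R * c`_j) *: mpolyX R (binary_exponent (d - j) j) ->
  apolar f g = coef_functional c (dehomog_poly g).
Proof.
move=> fE; have [bI _ _] := binary_exponent_enum d.
rewrite (apolarE _ _ (binary_exponent_enum d)) /coef_functional size_tuple.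
apply: eq_bigr => j _; rewrite coef_poly ltn_ord; congr (_ * _).
rewrite fE raddf_sum /= (bigD1 j) //= mcoeffZ mcoeffX eqxx mulr1.
rewrite big1 ?addr0 => [|i ij].
  rewrite -multinomial_coef_binary; last by rewrite -ltnS.
  by rewrite mulKf // multinomial_coef_neq0.
rewrite mcoeffZ mcoeffX.
case: eqP => [bij|_]; last by rewrite mulr0.
by case/eqP: ij; apply: bI.
Qed.

(** * Forms in affine coordinates and moments *)

Definition affine_eval (R : realType) n k (f : Sform R n.+1 k) (x : 'rV[R]_n) : R :=
  meval (fun i => if unlift ord0 i is Some j then x 0 j else 1) (val f).

Lemma affine_evalE (R : realType) n k (f : Sform R n.+1 k) x :
  affine_eval f x =
  \sum_(b : bmultinom n k.+1) mcoeff (homog_exponent k b) (val f) * monomial b x.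
Proof.
rewrite /affine_eval (meval_form _ _ (homog_exponent_enum n k)).
apply: eq_bigr => b _; congr (_ * _).
rewrite big_ord_recl unlift_none expr1n mul1r; apply: eq_bigr => i _.
by rewrite homog_exponentE liftK.
Qed.

Lemma exists_affine_monomial (R : realType) n k (a : multinom n) :
  (mdeg a <= k)%N ->
  exists f : Sform R n.+1 k, forall x, affine_eval f x = monomial a x.
Proof.
rewrite -ltnS => ak; have [hI hk _] := homog_exponent_enum n k.
have fh : mpolyX R (homog_exponent k a) \is ishomog1 k mdeg.
  by rewrite dhomogX /= (hk (BMultinom ak)).
exists (DHomog fh) => x; rewrite affine_evalE (bigD1 (BMultinom ak)) //=.
rewrite mcoeffX eqxx mul1r big1 ?addr0 // => b ba; rewrite mcoeffX.
case: eqP => [hab|_]; last by rewrite mul0r.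
by case/eqP: ba; apply: hI.
Qed.

Section Moments.
Context {R : realType} {n k : nat} (mu : {measure set (borel R n) -> \bar R}).
Hypothesis mu_fin : finite_moments mu k.
Implicit Type f : Sform R n.+1 k.

Lemma integrable_affine_eval f :
  mu.-integrable setT (EFin \o affine_eval f).
Proof.
rewrite (_ : _ \o _ = fun x : borel R n => (\sum_(b : bmultinom n k.+1)
    (mcoeff (homog_exponent k b) (val f))%:E * (monomial b x)%:E)%E).
  apply: integrable_sum => //= b _; apply: integrableZl => //.
  by apply: mu_fin; rewrite -ltnS bmdeg.
by apply/funext => x /=; rewrite affine_evalE -sumEFin.
Qed.

Lemma mcoeff_moment_form (b : bmultinom n k.+1) :
  mcoeff (homog_exponent k b) (val (moment_form mu k)) =
  multinomial_coef R (homog_exponent k b) * moment mu b.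
Proof.
have [hI _ _] := homog_exponent_enum n k.
rewrite /= raddf_sum /= (bigD1 b) //= mcoeffZ mcoeffX eqxx mulr1.
rewrite big1 ?addr0 // => b' b'b; rewrite mcoeffZ mcoeffX.
case: eqP => [hab|_]; last by rewrite mulr0.
by case/eqP: b'b; apply: hI.
Qed.

(** The multinomial factors of [moment_form] cancel the inverse ones of the apolar product, so this
    form represents integration against [mu]. *)
Lemma apolar_moment_form f :
  (\int[mu]_x (affine_eval f x)%:E = (apolar (moment_form mu k) f)%:E)%E.
Proof.
have monoI (b : bmultinom n k.+1) : mu.-integrable setT (EFin \o monomial b).
  by apply: mu_fin; rewrite -ltnS bmdeg.
rewrite (eq_integral (fun x : borel R n => (\sum_(b : bmultinom n k.+1)
    (mcoeff (homog_exponent k b) (val f))%:E * (monomial b x)%:E)%E)); last first.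
  by move=> x _; rewrite affine_evalE -sumEFin.
rewrite integral_sum //=; last by move=> b; apply: integrableZl => //; apply: monoI.
rewrite (apolarE _ _ (homog_exponent_enum n k)) -sumEFin; apply: eq_bigr => b _.
rewrite integralZl //; last exact: monoI.
rewrite mcoeff_moment_form mulKf ?multinomial_coef_neq0 // mulrC EFinM.
congr (_ * _)%E; rewrite /moment /Rintegral fineK //.
exact: integrable_fin_num (monoI b).
Qed.

End Moments.

Lemma meval_affine_eval (R : realType) n k (f : Sform R n.+1 k)
    (v : 'I_n.+1 -> R) :
  v ord0 != 0 ->
  meval v (val f) =
  v ord0 ^+ k * affine_eval f (\row_i (v (lift ord0 i) / v ord0)).
Proof.
move=> v0; rewrite affine_evalE (meval_form _ _ (homog_exponent_enum n k)).
rewrite mulr_sumr; apply: eq_bigr => b _; rewrite [RHS]mulrCA; congr (_ * _).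
have vk d : (d <= k)%N -> v ord0 ^+ (k - d) = v ord0 ^+ k / v ord0 ^+ d.
  by move=> dk; rewrite -{2}(subnK dk) exprD mulfK ?expf_neq0.
have bk : (mdeg b <= k)%N by rewrite -ltnS bmdeg.
rewrite big_ord_recl homog_exponentE unlift_none /monomial.
rewrite [X in _ = _ * X](eq_bigr (fun i : 'I_n =>
    v (lift ord0 i) ^+ homog_exponent k b (lift ord0 i) * v ord0 ^- b i)).
  by rewrite big_split /= prodfV prodrXr -mdegE mulrCA -vk // mulrC.
by move=> i _; rewrite mxE expr_div_n homog_exponentE liftK.
Qed.

(** * Apolarity and the q-symmetric tensors *)

Section QSymmetricTensors.
Context {R : realType} {n k h : nat} (q : 'I_n.+1 -> Sform R 2 h).
Implicit Types (f p : Sform R n.+1 k) (z : R).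

Lemma horner_W_q f z :
  dehomog (q ord0) z != 0 ->
  (dehomog_poly (W_q k q f)).[z] =
  dehomog (q ord0) z ^+ k * affine_eval f (varphi q z).
Proof.
move=> q0; rewrite horner_dehomog_poly lfunE /= comp_mpoly_meval.
rewrite -(meval_affine_eval _ (v := fun i => dehomog (q i) z)) //.
by apply: meval_eq => i; rewrite tnth_mktuple.
Qed.

Lemma apolar_isoE p f : apolar_iso n k p f = apolar p f.
Proof. by rewrite !lfunE. Qed.

(** A functional that vanishes on the kernel of [W_q] factors through [W_q], hence is in the image
    of the transpose. Two preimages under [W_q] differ by a kernel element, so the choice made by
    the inverse does not matter. *)
Lemma mem_qSym p :
  (forall f, W_q k q f = 0 -> apolar p f = 0) -> p \in qSym k q.
Proof.
move=> Wp; pose l := (apolar_iso n k p \o (W_q k q)^-1)%VF.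
have lW : transpose (W_q k q) l = apolar_iso n k p.
  apply/lfunP => u; rewrite transposeE comp_lfunE; apply/eqP.
  pose u' := ((W_q k q)^-1 (W_q k q u))%VF.
  have : apolar_iso n k p (u' - u) = 0.
    rewrite apolar_isoE Wp // linearB /= limg_lfunVK ?memv_img ?memvf //.
    exact: subrr.
  by rewrite linearB /= => /eqP; rewrite subr_eq0.
have -> : p = phi_q k q ((apolar_iso 1 (h * k))^-1%VF l).
  rewrite /phi_q !comp_lfunE limg_lfunVK ?apolar_iso_surj ?memvf // lW.
  by rewrite lker0_lfunK // apolar_iso_inj.
by rewrite memv_img // memvf.
Qed.

(** [phi_q] is the adjoint of [W_q] for the apolar products, and [psi_q] gives a preimage under
    it. *)
Lemma apolar_psi_q p f :
  p \in qSym k q -> apolar p f = apolar (psi_q k q p) (W_q k q f).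
Proof.
move=> pq; have : phi_q k q (psi_q k q p) = p by rewrite limg_lfunVK.
rewrite -apolar_isoE => {1}<-.
rewrite /phi_q !comp_lfunE limg_lfunVK ?apolar_iso_surj ?memvf //.
by rewrite transposeE !lfunE.
Qed.

End QSymmetricTensors.

(** * Finitely atomic measures *)

Lemma exists_atomic_measure d (T : measurableType d) (R : realType) s
    (lam : 'I_s -> R) (xi : 'I_s -> T) :
  (forall i, 0 <= lam i) ->
  exists nu : {measure set T -> \bar R},
    (forall B, nu B = \sum_(i < s) (lam i)%:E * \d_(xi i) B)%E /\
    forall f : T -> R, measurable_fun setT f ->
      (\int[nu]_x (f x)%:E = (\sum_(i < s) lam i * f (xi i))%:E)%E.
Proof.
move=> lam0.
(* [msum] takes a sequence indexed by [nat]; [mzero] only fills the indices from [s] on. *)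
pose m_ (j : nat) : {measure set T -> \bar R} :=
  if insub j is Some i then mscale (NngNum (lam0 i)) \d_(xi i) else mzero.
have mE (i : 'I_s) : m_ i = mscale (NngNum (lam0 i)) \d_(xi i).
  by rewrite /m_ valK.
have ge0_int (g : T -> R) : measurable_fun setT g -> (forall x, 0 <= g x) ->
    (\int[msum m_ s]_x (g x)%:E = (\sum_(i < s) lam i * g (xi i))%:E)%E.
  move=> /measurable_EFinP mg g0.
  rewrite ge0_integral_measure_sum //=; last by move=> x _; rewrite lee_fin.
  rewrite -sumEFin; apply: eq_bigr => i _.
  rewrite mE ge0_integral_mscale //=; last by move=> x _; rewrite lee_fin.
  by rewrite integral_dirac // diracT mul1e.
exists (msum m_ s : {measure set T -> \bar R}); split=> [B|f mf].
  by apply: eq_bigr => i _; rewrite mE.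
(* The non-negative case applies to the positive and negative parts, whose integrals are both
   finite. *)
rewrite integralE /= -[fun x => (f x)%:E]/(EFin \o f) funerpos funerneg.
rewrite [X in (X - _)%E]ge0_int //; last exact: measurable_funrpos.
rewrite [X in (_ - X)%E]ge0_int //; last exact: measurable_funrneg.
rewrite -EFinB -sumrB; congr EFin; apply: eq_bigr => i _.
rewrite -mulrBr; congr (_ * _).
by rewrite -[in RHS](funrposBneg f).
Qed.

Lemma integral_atomic d (T : measurableType d) (R : realType) s
    (lam : 'I_s -> R) (xi : 'I_s -> T) (nu : {measure set T -> \bar R})
    (f : T -> R) :
  (forall i, 0 <= lam i) ->
  (forall B, measurable B -> nu B = \sum_(i < s) (lam i)%:E * \d_(xi i) B)%E ->
  measurable_fun setT f ->
  (\int[nu]_x (f x)%:E = (\sum_(i < s) lam i * f (xi i))%:E)%E.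
Proof.
move=> lam0 nuE mf; have [nu' [nu'E <-//]] := exists_atomic_measure xi lam0.
by apply: eq_measure_integral => B mB _; rewrite nuE // nu'E.
Qed.

Lemma measurable_rV_set1 (R : realType) n (x : borel R n) :
  measurable [set x].
Proof.
suff : closed [set x : 'rV[R]_n].
  move=> /closed_openC xo; rewrite -[X in measurable X]setCK.
  by apply: measurableC; apply: sub_sigma_algebra.
case: n x => [|n] x; last first.
  exact/accessible_closed_set1/hausdorff_accessible/norm_hausdorff.
suff -> : [set x] = setT :> set 'rV[R]_0 by exact: closedT.
by apply/seteqP; split=> // y _ /=; apply/rowP => -[].
Qed.

Lemma set_seqU1 (T : eqType) (x : T) (t : seq T) :
  [set` x :: t] = [set x] `|` [set` t].
Proof.
apply/seteqP; split=> y /=; rewrite inE; first by case/predU1P; [left|right].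
by case=> [->|->]; rewrite ?eqxx ?orbT.
Qed.

Lemma measurable_rV_seq (R : realType) n (t : seq (borel R n)) :
  measurable [set` t].
Proof.
elim: t => [|x t IHt]; first by rewrite classical_sets.set_nil; exact: measurable0.
by rewrite set_seqU1; apply: measurableU => //; apply: measurable_rV_set1.
Qed.

Lemma measureI_seq (R : realType) n (mu : {measure set (borel R n) -> \bar R})
    (t : seq (borel R n)) (B : set (borel R n)) :
  uniq t -> measurable B ->
  (mu (B `&` [set` t]) = \sum_(x <- t) mu [set x] * \d_x B)%E.
Proof.
move=> + mB; elim: t => [|x t IHt] /= => [_|/andP[xt /IHt {}IHt]].
  by rewrite classical_sets.set_nil setI0 measure0 big_nil.
have mx : measurable [set x] := measurable_rV_set1 x.
have mt := measurable_rV_seq t.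
rewrite set_seqU1 setIUr big_cons -IHt measureU; last 3 first.
- exact: measurableI.
- exact: measurableI.
- apply/seteqP; split=> // y [[_ /= ->] [_ /=]].
  by rewrite (negPf xt).
congr (_ + _)%E; rewrite diracE.
case: (boolP (x \in B)) => [/set_mem Bx|/negP Bx]; rewrite ?mule1 ?mule0.
  by congr (mu _); apply/seteqP; split=> [y []//|y /= ->].
rewrite (_ : _ `&` _ = set0) ?measure0 //; apply/seteqP; split=> // y [By /= yx].
by apply: Bx; rewrite inE -yx.
Qed.

(** The weights are the point masses, finite because [mu] is; points of mass 0 are dropped to keep
    the weights positive. *)
Lemma finite_support_atomic (R : realType) n
    (mu : {measure set (borel R n) -> \bar R}) (t : seq 'rV[R]_n) :
  uniq t -> mu.-negligible (~` [set` t]) -> (mu setT < +oo)%E ->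
  exists s (lam : 'I_s -> R) (xi : 'I_s -> 'rV[R]_n),
    [/\ injective xi, forall i, xi i \in t, forall i, 0 < lam i &
      forall B : set (borel R n), measurable B ->
        (mu B = \sum_(i < s) (lam i)%:E * \d_(xi i : borel R n) B)%E].
Proof.
move=> ut mut muT; pose u := [seq x <- t | mu [set x] != 0%E].
have uu : uniq u by rewrite filter_uniq.
have mu1 (x : borel R n) : mu [set x] \is a fin_num.
  rewrite ge0_fin_numE //; apply: le_lt_trans muT; apply: le_measure => //.
    by rewrite inE; apply: measurable_rV_set1.
  by rewrite inE.
exists (size u), (fun i => fine (mu [set u`_i])), (fun i => u`_i); split.
- by move=> i j /eqP; rewrite nth_uniq // => /eqP /val_inj.
- by move=> i; have := mem_nth 0 (ltn_ord i); rewrite mem_filter => /andP[].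
- move=> i; have := mem_nth 0 (ltn_ord i); rewrite mem_filter => /andP[mui _].
  by rewrite fine_gt0 // lt0e mui measure_ge0 /= -ge0_fin_numE.
move=> B mB; have mt := measurable_rV_seq t.
have mu0 : mu (B `\` [set` t]) = 0%E.
  apply/negligibleP; first exact: measurableD.
  by apply: negligibleS mut => x [].
have -> : mu B = mu (B `&` [set` t]).
  by rewrite -[RHS]add0e -mu0; exact: measureDI.
rewrite measureI_seq // -(big_mkord xpredT (fun i => (fine (mu [set u`_i]))%:E *
  \d_(u`_i : borel R n) B)%E).
rewrite -(big_nth _ xpredT (fun x => (fine (mu [set x]))%:E * \d_x B)%E).
rewrite big_filter [RHS]big_mkcond; apply: eq_bigr => x _.
by case: eqVneq => [->|_]; rewrite ?mul0e // fineK.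
Qed.

(** * Ranks of Hankel matrices *)

(** The coefficients of the Lagrange basis form a right inverse. *)
Lemma row_free_vandermonde (F : fieldType) s N (z : 'I_s -> F) :
  injective z -> (s <= N)%N -> row_free (\matrix_(i < s, j < N) z i ^+ j).
Proof.
move=> zI sN; apply/row_freeP.
exists (\matrix_(j < N, i < s) (lagrange_basis z i)`_j); apply/matrixP => i i'.
rewrite !mxE eq_sym -(lagrange_basisE i' i zI).
rewrite (horner_coef_wide _ (leq_trans (size_lagrange_basis z i') sN)).
by apply: eq_bigr => j _; rewrite !mxE mulrC.
Qed.

Lemma rank_Hankel_atoms (R : realType) l (c : l.+1.-tuple R) s (z w : 'I_s -> R) :
  injective z -> (forall i, w i != 0) -> (s <= l./2.+1)%N ->
  (forall j, (j <= l)%N -> c`_j = \sum_(i < s) w i * z i ^+ j) ->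
  \rank (Hankel c) = s.
Proof.
move=> zI w0 sl cE; have lu : (l./2 <= uphalf l)%N by rewrite uphalf_half leq_addl.
pose V N : 'M[R]_(s, N) := \matrix_(i, j) z i ^+ j.
have freeV N : (s <= N)%N -> row_free (V N) by exact: row_free_vandermonde.
have -> : Hankel c =
    (V l./2.+1)^T *m diag_mx (\row_i w i) *m V (uphalf l).+1.
  apply/matrixP => i j; rewrite !mxE cE; last first.
    have := ltn_ord i; have := ltn_ord j; have := uphalf_half l.
    have := odd_double_half l; lia.
  apply: eq_bigr => a _; rewrite mul_mx_diag !mxE exprD; ring.
rewrite mxrankMfree ?freeV ?(leq_trans sl) // -mxrank_tr trmx_mul trmxK.
rewrite mxrankMfree ?freeV // mxrank_tr mxrank_unit // unitmxE det_diag unitfE.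
by apply/prodf_neq0 => i _; rewrite mxE.
Qed.

(** A row vector killed by the matrix is a polynomial orthogonal to all [X^j] with [j <= l./2], as
    the first [l./2.+1] columns show. *)
Lemma rank_Hankel_pos_def (R : realType) l (c : l.+1.-tuple R) :
  pos_def (coef_functional c) l./2.+1 -> \rank (Hankel c) = l./2.+1.
Proof.
move=> cpd; have lu : (l./2.+1 <= (uphalf l).+1)%N.
  by rewrite ltnS uphalf_half leq_addl.
apply/eqP/inj_row_free => v vH; apply: (can_inj (@rVpolyK _ _)).
rewrite linear0; apply: (pos_def_eq0 cpd) => [|j]; first exact: size_poly.
rewrite mulrC (scalar_poly_sum _ _ (size_poly _ _)).
transitivity ((v *m Hankel c) 0 (widen_ord lu j)); last by rewrite vH mxE.
rewrite mxE; apply: eq_bigr => i _; rewrite coef_rVpoly_ord -exprD.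
by rewrite -[LHS]/(_ * coef_functional c _) coef_functionalXn mxE addnC.
Qed.

(** * Quadrature on the curve *)

Lemma exists_root_seq (R : rcfType) (p : {poly R}) : p != 0 ->
  exists rs : seq R, [/\ uniq rs, (size rs < size p)%N &
    forall z, root p z = (z \in rs)].
Proof.
move=> p0; have rsP z : root p z = (z \in rootsR p).
  by have := roots_on_rootsR p0 z; rewrite in_itv.
exists (rootsR p); split=> //; first exact: uniq_roots.
apply: max_poly_roots => //; last exact: uniq_roots.
by apply/allP => z; rewrite -rsP.
Qed.

Section CurveQuadrature.
Context {R : realType} {n d k : nat} (c : d.+1.-tuple R).
Context (q0 : {poly R}) (phi : R -> 'rV[R]_n).
Context (mu : {measure set (borel R n) -> \bar R}).
Let C : set 'rV[R]_n := phi @` [set z | q0.[z] != 0].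
Local Notation Lam := (coef_functional c).
Hypothesis d_gt0 : (0 < d)%N.
Hypothesis q0k_ge0 : forall z, 0 <= q0.[z] ^+ k.
Hypothesis muC : supported_on mu C.
Hypothesis mu_fin : finite_moments mu k.
(** This is how surjectivity of [W_q] enters: [G] is the restriction of a form, and [F] is that form
    in affine coordinates. *)
Hypothesis lift_poly : forall G : {poly R}, (size G <= d.+1)%N ->
  exists F : borel R n -> R,
    [/\ mu.-integrable setT (EFin \o F),
        forall z, q0.[z] != 0 -> G.[z] = q0.[z] ^+ k * F (phi z) &
        (\int[mu]_x (F x)%:E = (Lam G)%:E)%E].
Hypothesis restrict_monomial : forall a : multinom n, (mdeg a <= k)%N ->
  exists G : {poly R},
    [/\ (size G <= d.+1)%N,
        forall z, q0.[z] != 0 -> G.[z] = q0.[z] ^+ k * monomial a (phi z) &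
        (\int[mu]_x (monomial a x)%:E = (Lam G)%:E)%E].

Lemma q0k_gt0 z : q0.[z] != 0 -> 0 < q0.[z] ^+ k.
Proof. by move=> z0; rewrite lt0r q0k_ge0 expf_neq0. Qed.

(* The functions lifting 1 and X separate the points of the curve. *)
Lemma curve_param_inj z z' :
  q0.[z] != 0 -> q0.[z'] != 0 -> phi z = phi z' -> z = z'.
Proof.
move=> z0 z'0 zz'; have [|F1 [_ F1E _]] := @lift_poly 1; first by rewrite size_poly1.
have [|FX [_ FXE _]] := @lift_poly 'X; first by rewrite size_polyX.
have := F1E z z0; have := F1E z' z'0; rewrite !hornerC -zz' => e' e.
have F0 : F1 (phi z) != 0.
  by apply/eqP => F0; move/eqP: e; rewrite F0 mulr0 oner_eq0.
have qq : q0.[z] ^+ k = q0.[z'] ^+ k by apply: (mulIf F0); rewrite -e -e'.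
have := FXE z z0; have := FXE z' z'0; rewrite !hornerX qq -zz' => ez' ez.
exact: etrans ez (esym ez').
Qed.

Lemma measurable_lift (F : borel R n -> R) :
  mu.-integrable setT (EFin \o F) -> measurable_fun setT F.
Proof. by move=> /measurable_int /measurable_EFinP. Qed.

Lemma ae_curve : {ae mu, forall x : borel R n, C x}.
Proof. exact: muC. Qed.

(** On the curve [F] is [G] divided by the positive [q0 ^+ k], so [Lam G] is the integral of [|F|];
    if it is 0, then [F] vanishes almost everywhere. *)
Lemma functional_ge0 (G : {poly R}) :
  (size G <= d.+1)%N -> (forall z, 0 <= G.[z]) ->
  0 <= Lam G /\ (Lam G = 0 ->
    mu.-negligible (~` (phi @` [set z | q0.[z] != 0 /\ root G z]))).
Proof.
move=> sG G0; have [F [Fi FE intF]] := lift_poly sG.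
move: (Fi) => /measurable_int mF.
have ae_filter := ae_filter_ringOfSetsType mu.
have aeF : ae_eq mu setT (EFin \o F) (fun x => `|(F x)%:E|)%E.
  have := ae_curve; apply: filterS => x [z z0 <-] _ /=; rewrite ger0_norm //.
  by rewrite -(pmulr_rge0 _ (q0k_gt0 z0)) -FE.
have intaF : (\int[mu]_x `|(F x)%:E| = (Lam G)%:E)%E.
  rewrite -intF; apply/esym/ae_eq_integral => //.
  exact: measurableT_comp.
split; first by rewrite -lee_fin -intaF integral_ge0.
move=> LG0; move: intaF; rewrite LG0 => /(ae_eq_integral_abs _ measurableT mF).
move=> F0; apply: filterS2 ae_curve F0 => x [z z0 <-] /(_ I) /= [Fz0].
by exists z => //; split => //; rewrite /root FE // Fz0 mulr0.
Qed.

(** The bound on the rank excludes [2r = d+1], so [r] nodes are always the required number here. *)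
Lemma quadrature_singular (g : {poly R}) :
  g != 0 -> (size g <= d./2.+1)%N -> Lam (g ^+ 2) = 0 ->
  (\rank (Hankel c) <= d./2)%N /\
  exists nu, quadrature_formula mu k (\rank (Hankel c)) C nu.
Proof.
move=> g0 sg Lg0; have sg2 : (size (g ^+ 2) <= d.+1)%N.
  apply: leq_trans (size_poly_sqr sg) _.
  by rewrite ltnS -{2}(odd_double_half d) leq_addl.
have [z|_ /(_ Lg0) muS] := functional_ge0 sg2; first by rewrite horner_exp sqr_ge0.
have [rs [urs srs rsP]] := exists_root_seq g0.
pose t := undup [seq phi z | z <- rs & q0.[z] != 0].
have tP x : x \in t -> exists z, [/\ q0.[z] != 0, z \in rs & x = phi z].
  rewrite mem_undup => /mapP[z]; rewrite mem_filter => /andP[z0 zr] ->.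
  by exists z.
have mut : mu.-negligible (~` [set` t]).
  apply: negligibleS muS; apply: subsetC => _ [z [z0 gz] <-] /=.
  rewrite mem_undup map_f // mem_filter z0 -rsP.
  by move: gz; rewrite /root horner_exp expf_eq0.
have muT : (mu setT < +oo)%E.
  have deg0 : (mdeg (@mnm0 n) <= k)%N by rewrite mdeg0.
  have /integrableP[_] := mu_fin deg0.
  rewrite (eq_integral (cst 1%E)) ?integral_cst ?mul1e // => x _ /=.
  by rewrite /monomial big1 ?normr1 // => i _; rewrite mnm0E.
have [s [lam [xi [xiI xit lam0 muE]]]] := finite_support_atomic (undup_uniq _) mut muT.
have /choice[z zP] : forall i, exists z, [/\ q0.[z] != 0, z \in rs & xi i = phi z].
  by move=> i; apply: tP.
have zI : injective z.
  by move=> i j zij; apply: xiI; have [_ _ ->] := zP i; have [_ _ ->] := zP j; rewrite zij.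
(* Distinct atoms come from distinct roots of [g], and there are fewer of these than [size g]. *)
have sd : (s <= d./2)%N.
  rewrite -ltnS; apply: leq_trans sg; apply: leq_ltn_trans srs.
  rewrite -[s]card_ord -(size_codom z); apply: uniq_leq_size.
    by rewrite map_inj_uniq ?enum_uniq.
  by move=> _ /codomP[i ->]; have [] := zP i.
have -> : \rank (Hankel c) = s.
  (* Pulled back to the line, the atom at [xi i] has weight [lam i / q0.[z i] ^+ k], and the [c_j]
     become power moments. *)
  apply: (rank_Hankel_atoms (z := z) (w := fun i => lam i / q0.[z i] ^+ k)) => //.
  - by move=> i; have [zi _ _] := zP i; rewrite mulf_neq0 ?invr_eq0 ?gt_eqF ?q0k_gt0.
  - exact: leqW.
  move=> j jd; have [|F [Fi FE intF]] := @lift_poly 'X^j; first by rewrite size_polyXn.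
  have := intF; rewrite (integral_atomic (fun i => ltW (lam0 i)) muE (measurable_lift Fi)).
  have -> : Lam 'X^j = c`_j := coef_functionalXn c j; move=> -[<-]; apply: eq_bigr => i _.
  have [zi _ xiE] := zP i; rewrite -mulrA; congr (_ * _).
  have := FE _ zi; rewrite hornerXn xiE => ->.
  by rewrite mulKf // expf_neq0.
split=> //; exists mu, lam, xi; split=> // i.
by have [zi _ ->] := zP i; exists (z i).
Qed.

Lemma quadrature_lift s (z w : 'I_s -> R) :
  injective z -> (forall i, q0.[z i] != 0) -> (forall i, 0 < w i) ->
  (forall p : {poly R}, (size p <= d.+1)%N ->
     Lam p = \sum_(i < s) w i * p.[z i]) ->
  exists nu, quadrature_formula mu k s C nu.
Proof.
move=> zI z0 w0 LamE; pose lam i := w i * q0.[z i] ^+ k.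
have lam0 i : 0 < lam i by rewrite mulr_gt0 ?q0k_gt0.
have [nu [nuE nu_int]] :=
  exists_atomic_measure (fun i => phi (z i) : borel R n) (fun i => ltW (lam0 i)).
exists nu, lam, (fun i => phi (z i)); split=> //.
- by move=> i j /(curve_param_inj (z0 i) (z0 j))/zI.
- by move=> i; exists (z i) => //; apply: z0.
move=> a ak; have [G [sG GE ->]] := restrict_monomial ak.
rewrite nu_int; last exact: measurable_lift (mu_fin ak).
congr EFin; rewrite LamE //; apply: eq_bigr => i _.
by rewrite GE // mulrA.
Qed.

Lemma curve_quadrature (r := \rank (Hankel c)) :
  (r.*2 <> d.+1 -> exists nu, quadrature_formula mu k r C nu) /\
  (r.*2 = d.+1 -> exists nu, quadrature_formula mu k r.+1 C nu).
Proof.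
have dE := odd_double_half d.
have [[g [g0 sg Lg0]]|npd] := pselect (exists g : {poly R},
    [/\ g != 0, (size g <= d./2.+1)%N & Lam (g ^+ 2) = 0]).
  have [rd qf] := quadrature_singular g0 sg Lg0.
  by split=> // r2; exfalso; move: rd; rewrite -/r; lia.
have cpd : pos_def Lam d./2.+1.
  move=> g g0 sg; rewrite lt0r; apply/andP; split.
    by apply/eqP => Lg0; apply: npd; exists g.
  have [|z|//] := @functional_ge0 (g ^+ 2).
    by apply: leq_trans (size_poly_sqr sg) _; lia.
  by rewrite horner_exp sqr_ge0.
have rE : r = d./2.+1 := rank_Hankel_pos_def cpd.
(* If [q0] were 0, the curve would be empty and [mu] null, so [Lam 1 = 0], against positive
   definiteness. *)
have q0_neq0 : q0 != 0.
  apply/eqP => q00; apply: npd; exists 1; rewrite size_poly1 oner_eq0; split=> //.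
  have [|F [Fi _ intF]] := @lift_poly 1; first by rewrite size_poly1.
  have ae_filter := ae_filter_ringOfSetsType mu.
  have : (\int[mu]_x (F x)%:E = \int[mu]_x cst 0 x)%E.
    apply: ae_eq_integral => //; first by move: Fi => /measurable_int.
    by apply: filterS ae_curve => x [z]; rewrite /= q00 horner0 eqxx.
  by rewrite intF integral0 expr1n => -[].
have [bad [_ _ badP]] := exists_root_seq q0_neq0.
(* As [r = d./2.+1], the equality [2r = d+1] holds exactly for odd [d]. *)
have [d_odd|d_even] := boolP (odd d).
  split; first by rewrite rE; lia.
  move=> _; have [z [w [zI zb w0 LamE]]] := gauss_quadrature_odd bad cpd.
  rewrite rE; apply: (quadrature_lift zI) w0 _ => [i|p sp].
    by have := zb i; rewrite -badP.
  by apply: LamE; apply: leq_trans sp _; lia.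
split; last by rewrite rE; lia.
move=> _; have [z [w [zI zb w0 LamE]]] := gauss_quadrature bad cpd.
rewrite rE; apply: (quadrature_lift zI) w0 _ => [i|p sp].
  by have := zb i; rewrite -badP.
by apply: LamE; apply: leq_trans sp _; lia.
Qed.

End CurveQuadrature.

(** * The moment form as a q-symmetric tensor, and its quadrature *)

Lemma moment_form_qSym (R : realType) (n k h : nat) (q : 'I_n.+1 -> Sform R 2 h)
    (mu : {measure set (borel R n) -> \bar R}) :
  supported_on mu (curve q) -> finite_moments mu k ->
  moment_form mu k \in qSym k q.
Proof.
move=> muC mu_fin; apply: mem_qSym => f Wf0; apply: EFin_inj.
rewrite -apolar_moment_form //.
have ae_filter := ae_filter_ringOfSetsType mu.
have aeC : {ae mu, forall x : borel R n, curve q x} := muC.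
rewrite -[RHS](@integral0 _ _ _ mu setT); apply: ae_eq_integral => //.
  by have := integrable_affine_eval mu_fin f => /measurable_int.
apply: filterS aeC => x [z z0 <-] _; congr EFin.
(* From [W_q f = 0], the product of [q_0(1, z)^k] and the integrand is 0 on the curve, where the
   first factor is nonzero. *)
have := horner_W_q f z0; rewrite Wf0 horner_dehomog_poly raddf0 => /esym/eqP.
by rewrite mulf_eq0 expf_eq0 (negPf z0) andbF => /eqP.
Qed.

Theorem theorem3p32 (R : realType) (n k h : nat) (q : 'I_n.+1 -> Sform R 2 h)
    (mu : {measure set (borel R n) -> \bar R}) :
  (0 < n)%N -> (0 < k)%N -> (0 < h)%N ->
  limg (W_q k q) = fullv ->
  (forall z : R, 0 <= dehomog (q ord0) z ^+ k) ->
  supported_on mu (curve q) ->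
  finite_moments mu k ->
  moment_form mu k \in qSym k q /\
  forall c : (h * k).+1.-tuple R,
    val (psi_q k q (moment_form mu k)) =
      \sum_(j < (h * k).+1)
         ('C(h * k, j)%:R * c`_j) *: mpolyX R (binary_exponent (h * k - j) j) ->
    let r := \rank (Hankel c) in
    [/\ (r <= uphalf (h * k).+1)%N,
        r.*2 <> (h * k).+1 ->
          exists nu, quadrature_formula mu k r (curve q) nu
      & r.*2 = (h * k).+1 ->
          exists nu, quadrature_formula mu k r.+1 (curve q) nu].
Proof.
move=> _ k_gt0 h_gt0 W_surj q0k_ge0 muC mu_fin.
have pq := moment_form_qSym muC mu_fin; split=> // c cE r.
pose q0 := dehomog_poly (q ord0).
have q0E z : q0.[z] = dehomog (q ord0) z by rewrite horner_dehomog_poly.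
have curveE : curve q = varphi q @` [set z | q0.[z] != 0].
  by rewrite /curve; congr image; apply/funext => z; rewrite /mkset q0E.
(* The integral is the apolar product of [f] with the moment form, hence that of [W_q f] with its
   image under [psi_q], which is the functional of the [c_j]. *)
have LamE (f : Sform R n.+1 k) :
    (\int[mu]_x (affine_eval f x)%:E =
     (coef_functional c (dehomog_poly (W_q k q f)))%:E)%E.
  by rewrite apolar_moment_form // (apolar_psi_q _ pq) (apolar_binary _ cE).
have WE (f : Sform R n.+1 k) z : q0.[z] != 0 ->
    (dehomog_poly (W_q k q f)).[z] = q0.[z] ^+ k * affine_eval f (varphi q z).
  by rewrite q0E; apply: horner_W_q.
have [] := @curve_quadrature R n (h * k) k c q0 (varphi q) mu.
- by rewrite muln_gt0 h_gt0.
- by move=> z; rewrite q0E.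
- by rewrite -curveE.
- exact: mu_fin.
- move=> G /dehomog_poly_surj[g <-].
  have /memv_imgP[f _ ->] : g \in limg (W_q k q) by rewrite W_surj memvf.
  exists (affine_eval f); split=> //; last exact: WE.
  exact: integrable_affine_eval.
- move=> a /(exists_affine_monomial R)[f fE]; exists (dehomog_poly (W_q k q f)).
  split; first exact: size_poly.
    by move=> z /WE ->; rewrite fE.
  by rewrite -LamE; apply: eq_integral => x _; rewrite fE.
(* The bound on [r] is the number of rows, [(h * k)./2.+1]. *)
by rewrite -curveE => ? ?; split=> //; apply: rank_leq_row.
Qed.
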